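(* Let $n\ge 2$. A polynomial pencil $\mathcal{L}\subset\mathcal{H}_n$ is an $LD$-pencil if and only if there is a basis $\{P,Q\}$ of $\mathcal{L}$ such that the root map restricted to the shift $\mathcal{L}_s(P,Q)$ has a local minimum with respect to the spectral order, i.e. there exist $\lambda_0\in\mathbb{R}$ and $\varepsilon>0$ such that $$P(x+\lambda_0)-\lambda_0Q(x+\lambda_0)\preccurlyeq P(x+\lambda)-\lambda Q(x+\lambda)\quad\text{for all }\lambda\in(\lambda_0-\varepsilon,\lambda_0+\varepsilon).$$
   Context: $\mathcal{R}_n$ is the set of monic real polynomials of degree $n$ and $\mathcal{H}_n\subset\mathcal{R}_n$ the subset of those with only real zeros. $\mathcal{Z}(P)$ is the unordered $n$-tuple of zeros of $P$ counted with multiplicity (the map $\mathcal{Z}$ is the root map). For $n$-tuples $X=(x_1,\dots,x_n)$, $Y=(y_1,\dots,y_n)$ of real numbers, $X\prec Y$ ($X$ is majorized by $Y$, or less than $Y$ in the spectral order) means that $\sum_i f(x_i)\le\sum_i f(y_i)$ for every convex $f:\mathbb{R}\to\mathbb{R}$ (equivalently $X=AY$ for some doubly stochastic matrix $A$). For $P,Q\in\mathcal{H}_n$, $P\preccurlyeq Q$ means $\mathcal{Z}(P)\prec\mathcal{Z}(Q)$; this is a partial order on $\mathcal{H}_n$. A polynomial pencil in $\mathcal{R}_n$ is a real line $\mathcal{L}=\{(1-\lambda)P_1+\lambda P_2\mid\lambda\in\mathbb{R}\}$ through two distinct $P_1,P_2\in\mathcal{R}_n$. A basis of $\mathcal{L}$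 is a pair of real polynomials $\{P,Q\}$ with $P\in\mathcal{R}_n$, $\deg Q\le n-1$, the dominant (leading) coefficient of $Q$ equal to $n$, and $\mathcal{L}=\{P-\lambda Q\mid\lambda\in\mathbb{R}\}$. The $\{P,Q\}$-shift of $\mathcal{L}$ is $\mathcal{L}_s(P,Q)=\{P(x+\lambda)-\lambda Q(x+\lambda)\mid\lambda\in\mathbb{R}\}$. $\mathcal{L}$ is an $LD$-pencil (of logarithmic derivative type) if there exist $Q_1,Q_2,Q_3\in\mathcal{L}$ with $Q_3'=Q_1-Q_2$; equivalently, it has a basis of the form $\{P,P'\}$. *)

(* Defs.v *)
From HB Require Import structures.
From mathcomp Require Import all_boot all_order all_algebra.
From mathcomp Require Import all_classical all_reals all_analysis.
From mathcomp Require Import polyrcf complex.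

Set Implicit Arguments.
Unset Strict Implicit.
Unset Printing Implicit Defensive.

Import Order.TTheory GRing.Theory Num.Theory.

Local Open Scope classical_set_scope.
Local Open Scope ring_scope.

Definition monic_deg (R : realType) (n : nat) : set {poly R} :=
  [set P | P \is monic /\ size P = n.+1].

(* "Only real zeros" is a condition on all the complex zeros of P. *)
Definition hyperbolic (R : realType) (n : nat) : set {poly R} :=
  [set P | monic_deg n P /\
    forall z : R[i], root (map_poly (real_complex R) P) z ->
      exists x : R, z = real_complex R x].

(* The real zeros of P, each repeated according to its multiplicity. For a
   hyperbolic P of degree n these are all the zeros and the sequence has size n.
   The zeros are listed in increasing order; the majorization below does not
   depend on the order. *)
Definition root_map (R : realType) (P : {poly R}) : seq R :=
  flatten [seq nseq (mup x P) x | x <- rootsR P].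

(* X and Y are meant to have the same size; this is in fact implied, since the
   constant functions 1 and -1 are convex. *)
Definition majorized (R : realType) (X Y : seq R) : Prop :=
  forall f : R^o -> R^o, convex_function setT f ->
    \sum_(x <- X) f x <= \sum_(y <- Y) f y.

Definition spectral_le (R : realType) (P Q : {poly R}) : Prop :=
  majorized (root_map P) (root_map Q).

Definition is_pencil (R : realType) (n : nat) (L : set {poly R}) : Prop :=
  exists P1 P2 : {poly R}, [/\ monic_deg n P1, monic_deg n P2, P1 != P2 &
    L = [set (1 - l) *: P1 + l *: P2 | l in [set: R]]].

(* [size Q <= n] says deg Q <= n - 1. *)
Definition is_basis (R : realType) (n : nat) (L : set {poly R})
    (P Q : {poly R}) : Prop :=
  [/\ monic_deg n P, (size Q <= n)%N, lead_coef Q = n%:R &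
    L = [set P - l *: Q | l in [set: R]]].

Definition is_LD (R : realType) (L : set {poly R}) : Prop :=
  exists Q1 Q2 Q3 : {poly R}, [/\ L Q1, L Q2, L Q3 & Q3^`() = Q1 - Q2].

(* The element P(x + l) - l Q(x + l) of the {P, Q}-shift. *)
Definition pencil_shift (R : realType) (P Q : {poly R}) (l : R) : {poly R} :=
  (P \Po ('X + l%:P)) - l *: (Q \Po ('X + l%:P)).

(* Main.v *)
(* If [L] has a basis [{P, P'}], the shift attains its minimum at [0]. Let [P]
   have distinct zeros [x] with multiplicities [m x], and let [y] run over the
   zeros of [P - l P'] that are not zeros of [P]; they are the zeros of
   [1 - l \sum_x m x / (X - x)] and are simple. The partial fraction expansion
   of the inverse of this function shows that the nonnegative weights
   [W x y = (m x / (y - x)^2) / \sum_z m z / (y - z)^2] have all row and column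
   sums equal to [1], with [\sum_y W x y (y - x) = l m x]. Hence [m x] copies of
   [x] are the mean of the points [y - l] with weights [W x y] and of [m x - 1]
   copies of [x - l], and convexity gives the majorization.

   Conversely, for [c] larger than all zeros of [R_l = P(X + l) - l Q(X + l)]
   with [l] near [l0], the function [x |-> - ln (c - x)], extended affinely to
   the right of the zeros, is convex, and its sum over the zeros of [R_l] is
   [- ln R_l(c)]. So [l |-> R_l(c)] has a local maximum at [l0], where its
   derivative is [(P' - l0 Q' - Q)(c + l0)]. This vanishes for all large [c],
   whence [(P - l0 Q)' = Q]. *)
Require Import Defs.
From HB Require Import structures.
From mathcomp Require Import all_boot all_order all_algebra.
From mathcomp Require Import all_classical all_reals all_analysis.
From mathcomp Require Import polyrcf polyorder complex ring lra.

Set Implicit Arguments.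
Unset Strict Implicit.

Import Order.TTheory GRing.Theory Num.Theory.
Local Open Scope classical_set_scope.
Local Open Scope ring_scope.

(** * Convex functions and subgradients *)

Lemma convex_functionE (R : realType) (f : R^o -> R^o) :
  convex_function setT f <-> forall t x y : R, 0 <= t <= 1 ->
    f (t * x + (1 - t) * y) <= t * f x + (1 - t) * f y.
Proof.
split=> [cf t x y /andP[t0 t1]|cf t x y _ _].
  have := cf (Itv01 t0 t1) x y; rewrite !in_setT => /(_ isT isT).
  by rewrite [X in _ <= X]convRE; apply.
rewrite [X in _ <= X]convRE.
by apply: cf; rewrite ge0 le1.
Qed.

Lemma convex_slope_le (R : realType) (f : R^o -> R^o) (a b c : R) :
  convex_function setT f -> a < b -> b < c ->
  (f b - f a) / (b - a) <= (f c - f b) / (c - b).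
Proof.
move=> cf ab bc.
have ac : 0 < c - a by lra.
have t01 : 0 <= (c - b) / (c - a) <= 1.
  rewrite divr_ge0 ?ler_pdivrMr ?mul1r; lra.
have := (convex_functionE f).1 cf _ a c t01.
have -> : (c - b) / (c - a) * a + (1 - (c - b) / (c - a)) * c = b.
  by field; rewrite gt_eqF.
have -> : 1 - (c - b) / (c - a) = (b - a) / (c - a) by field; rewrite gt_eqF.
rewrite mulrAC [X in _ + X]mulrAC -mulrDl ler_pdivlMr // => H.
rewrite ler_pdivrMr ?subr_gt0 // mulrAC ler_pdivlMr ?subr_gt0 //; lra.
Qed.

(** Every chord slope to the right of [x] bounds the chord slopes to its left, so the supremum of
    the latter is a subgradient. *)
Lemma convex_subgradient (R : realType) (f : R^o -> R^o) (x : R) :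
  convex_function setT f -> exists g : R, forall y, f x + g * (y - x) <= f y.
Proof.
move=> cf.
pose E := [set (f x - f y) / (x - y) | y in [set y | y < x]].
have Eub z : x < z -> ubound E ((f z - f x) / (z - x)).
  by move=> xz _ [y /= yx <-]; exact: convex_slope_le.
have E0 : E !=set0.
  by exists ((f x - f (x - 1)) / (x - (x - 1))), (x - 1) => //=; lra.
exists (sup E) => y.
have [yx|xy|->] := ltgtP y x; last by rewrite subrr mulr0 addr0.
- have : (f x - f y) / (x - y) <= sup E.
    apply: ub_le_sup; last by exists y.
    by exists ((f (x + 1) - f x) / (x + 1 - x)); apply: Eub; lra.
  rewrite ler_pdivrMr ?subr_gt0 //; lra.
- have := ge_sup E0 (Eub y xy); rewrite ler_pdivlMr ?subr_gt0 //; lra.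
Qed.

(** The tangent inequalities at [t * x + (1 - t) * y] are averaged with weights [t] and [1 - t]; the
    linear terms cancel. *)
Lemma subgradient_convex (R : realType) (f g : R -> R) :
  (forall x y, f x + g x * (y - x) <= f y) ->
  convex_function setT (f : R^o -> R^o).
Proof.
move=> fg; apply/convex_functionE => t x y /andP[t0 t1].
have := ler_wpM2l t0 (fg (t * x + (1 - t) * y) x).
have /ler_wpM2l/(_ _ _ (fg (t * x + (1 - t) * y) y)) : 0 <= 1 - t by lra.
lra.
Qed.

(** * Products of linear factors and their shifts *)

(** The complex factorization has only real roots, so taking real parts loses nothing, and it
    descends to [R] by injectivity of the coefficient embedding. *)
Lemma hyperbolic_split (R : realType) (n : nat) (P : {poly R}) :
  hyperbolic n P -> exists s : seq R, P = \prod_(x <- s) ('X - x%:P).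
Proof.
move=> [[mP _] hP].
have [r] := closed_field_poly_normal (map_poly (real_complex R) P).
rewrite lead_coef_map (monicP mP) rmorph1 scale1r => Pr.
exists (map (@complex.Re R) r); rewrite big_map.
apply: (map_poly_inj (real_complex R)).
rewrite Pr rmorph_prod [LHS]big_seq [RHS]big_seq; apply: eq_bigr => z zr.
have [|x ->] := hP z; first by rewrite Pr root_prod_XsubC.
by rewrite rmorphB /= map_polyX map_polyC.
Qed.

Lemma root_map_prod_XsubC (R : realType) (s : seq R) :
  perm_eq (root_map (\prod_(x <- s) ('X - x%:P))) s.
Proof.
set P := \prod_(x <- s) _.
have P0 : P != 0 by rewrite monic_neq0 ?monic_prod_XsubC.
apply: perm_trans (perm_count_undup s); rewrite /root_map.
under eq_map do rewrite mu_prod_XsubC.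
apply/perm_flatten/perm_map/uniq_perm; rewrite ?undup_uniq ?uniq_roots //.
move=> x; rewrite mem_undup -[RHS]root_prod_XsubC.
by have := roots_on_rootsR P0 x; rewrite in_itv /= => <-.
Qed.

Lemma comp_prod_XsubC (R : comNzRingType) (s : seq R) (l : R) :
  (\prod_(x <- s) ('X - x%:P)) \Po ('X + l%:P) =
  \prod_(x <- [seq x - l | x <- s]) ('X - x%:P).
Proof.
rewrite rmorph_prod big_map; apply: eq_bigr => x _ /=.
by rewrite comp_polyB comp_polyX comp_polyC polyCB opprB addrA addrAC.
Qed.

Lemma pencil_shiftE (R : realType) (P Q : {poly R}) (l : R) :
  pencil_shift P Q l = (P - l *: Q) \Po ('X + l%:P).
Proof. by rewrite /pencil_shift comp_polyB comp_polyZ. Qed.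

(** * Lagrange interpolation and simple zeros *)

(** For [x] in a duplicate-free [u] this is, up to scaling, the Lagrange basis polynomial at the
    node [x]. *)
Definition omit (F : fieldType) (u : seq F) (x : F) : {poly F} :=
  \prod_(z <- u | z != x) ('X - z%:P).

Lemma prod_XsubC_omit (F : fieldType) (u : seq F) (x : F) :
  uniq u -> x \in u -> \prod_(z <- u) ('X - z%:P) = ('X - x%:P) * omit u x.
Proof. by move=> uu xu; rewrite (bigD1_seq x). Qed.

Lemma horner_omit (F : fieldType) (u : seq F) (x y : F) :
  uniq u -> x \in u -> y != x ->
  (omit u x).[y] = (\prod_(z <- u) ('X - z%:P)).[y] / (y - x).
Proof.
move=> uu xu yx; rewrite (prod_XsubC_omit uu xu) hornerM hornerXsubC.
by rewrite mulrC mulKf // subr_eq0.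
Qed.

Lemma horner_prod_XsubC_root (F : fieldType) (u : seq F) (x : F) :
  x \in u -> (\prod_(z <- u) ('X - z%:P)).[x] = 0.
Proof. by rewrite -root_prod_XsubC => /rootP. Qed.

Lemma size_omit (F : fieldType) (u : seq F) (x : F) :
  x \in u -> (size (omit u x) <= size u)%N.
Proof.
move=> xu; rewrite /omit -big_filter size_prod_XsubC size_filter.
rewrite -(count_predC (fun z => z != x) u) -addn1 leq_add2l.
by rewrite -has_count; apply/hasP; exists x; rewrite //= eqxx.
Qed.

Lemma lagrange_prod_XsubC (F : fieldType) (u : seq F) (h : {poly F}) :
  uniq u -> (size h <= size u)%N ->
  h = \sum_(y <- u) (h.[y] / (omit u y).[y]) *: omit u y.
Proof.
move=> uu hu; apply/eqP; rewrite -subr_eq0; apply/eqP.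
apply: (@roots_geq_poly_eq0 _ _ u) => //; last first.
  rewrite (leq_trans (size_polyD _ _)) // size_polyN geq_max hu /=.
  rewrite (leq_trans (size_sum _ _ _)) //; apply/bigmax_leqP_seq => y yu _.
  by rewrite (leq_trans (size_scale_leq _ _)) // size_omit.
apply/allP => y yu; rewrite rootE hornerD hornerN horner_sum (bigD1_seq y) //=.
rewrite big1_seq ?addr0 => [|z /andP[zy zu]]; last first.
  rewrite hornerZ [X in _ * X]horner_omit 1?eq_sym //.
  by rewrite horner_prod_XsubC_root // mul0r mulr0.
rewrite hornerZ divfK ?subrr // horner_prod prodf_seq_neq0.
by apply/allP => z _; rewrite hornerXsubC subr_eq0 eq_sym implybb.
Qed.

(* The logarithmic derivative of [\prod_(x <- t) ('X - x)] is
   [\sum_(x <- t) ('X - x)^-1], here with denominators cleared. *)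
Lemma deriv_prod_XsubC_omit (F : fieldType) (u t : seq F) :
  uniq u -> {subset t <= u} ->
  (\prod_(x <- t) ('X - x%:P))^`() * \prod_(x <- u) ('X - x%:P) =
  \prod_(x <- t) ('X - x%:P) * \sum_(x <- t) omit u x.
Proof.
move=> uu; elim: t => [|a t IH] tu.
  by rewrite !big_nil derivC mulr0 mul0r.
have {}IH := IH (fun x xt => tu x (@mem_behead _ (a :: t) x xt)).
rewrite [\prod_(x <- a :: t) _]big_cons [\sum_(x <- a :: t) _]big_cons.
rewrite derivM derivXsubC mul1r mulrDl -mulrA IH.
by rewrite {1}(prod_XsubC_omit uu (tu a (mem_head _ _))); ring.
Qed.

(** A repeated zero would also be a zero of the derivative. *)
Lemma uniq_prod_XsubC_deriv (F : fieldType) (u : seq F) :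
  {in u, forall y, (\prod_(z <- u) ('X - z%:P))^`().[y] != 0} -> uniq u.
Proof.
elim: u => //= a u IH; rewrite big_cons derivM derivXsubC mul1r => H.
rewrite IH ?andbT => [|y yu].
  have := H a (mem_head _ _); rewrite !hornerE subrr mul0r addr0.
  by apply: contraNN; rewrite -root_prod_XsubC => /rootP->.
have := H y (@mem_behead _ (a :: u) y yu).
rewrite !hornerE horner_prod_XsubC_root // add0r.
by rewrite mulf_eq0 negb_or => /andP[].
Qed.

Lemma deriv_prod_XsubC_root (F : fieldType) (u : seq F) (y : F) :
  uniq u -> y \in u ->
  (\prod_(z <- u) ('X - z%:P))^`().[y] = (omit u y).[y].
Proof.
move=> uu yu; rewrite (prod_XsubC_omit uu yu) derivM derivXsubC mul1r.
by rewrite !hornerE subrr mul0r addr0.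
Qed.

(** * The doubly stochastic weights *)

(** Interpolating at the nodes [u] and evaluating at [x], the polynomial [omit D x] yields the row
    sum and [q] the first moment; the column sums are [1] by the normalization with [N]. *)
Lemma doubly_stochastic_weights (F : realFieldType) (D u : seq F)
    (m : F -> F) (l : F) :
  uniq D -> {in D, forall x, 0 < m x} -> l != 0 ->
  size u = size D ->
  \prod_(x <- D) ('X - x%:P) - l *: \sum_(x <- D) m x *: omit D x =
    \prod_(y <- u) ('X - y%:P) ->
  exists W : F -> F -> F,
    [/\ {in D & u, forall x y, 0 <= W x y},
        {in D, forall x, \sum_(y <- u) W x y = 1},
        {in u, forall y, \sum_(x <- D) W x y = 1} &
        {in D, forall x, \sum_(y <- u) W x y * (y - x) = m x * l}].
Proof.
move=> uD m0 l0 szu; set p := \prod_(x <- D) _; set q := \sum_(x <- D) _.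
set s := \prod_(y <- u) _ => ps.
have qE x : x \in D -> q.[x] = m x * (omit D x).[x].
  move=> xD; rewrite horner_sum (bigD1_seq x) //= hornerZ big1_seq ?addr0 //.
  move=> z /andP[zx zD].
  rewrite hornerZ [X in _ * X]horner_omit 1?eq_sym //.
  by rewrite horner_prod_XsubC_root // mul0r mulr0.
have omit0 x : (omit D x).[x] != 0.
  rewrite horner_prod prodf_seq_neq0.
  by apply/allP => z _; rewrite hornerXsubC subr_eq0 eq_sym implybb.
have sx x : x \in D -> s.[x] = - (l * (m x * (omit D x).[x])).
  move=> xD; rewrite -ps hornerD hornerN hornerZ horner_prod_XsubC_root //.
  by rewrite qE // add0r.
(* [s] does not vanish on [D], by [sx], so [D] and [u] are disjoint. *)
have yx x y : x \in D -> y \in u -> y - x != 0.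
  move=> xD yu; rewrite subr_eq0; apply/eqP => yx.
  have /eqP := sx x xD; rewrite -yx horner_prod_XsubC_root // eq_sym oppr_eq0.
  by rewrite yx !mulf_eq0 (negPf l0) (negPf (omit0 x)) gt_eqF ?m0.
have nyx x y : x \in D -> y \in u -> y != x.
  by move=> xD yu; rewrite -subr_eq0 yx.
have nxy x y : x \in D -> y \in u -> x != y.
  by move=> xD yu; rewrite eq_sym nyx.
have p0 y : y \in u -> p.[y] != 0.
  move=> yu; rewrite horner_prod prodf_seq_neq0; apply/allP => x xD.
  by rewrite /= hornerXsubC yx.
pose N y := \sum_(x <- D) m x / (y - x) ^+ 2.
have N0 y : y \in u -> 0 < N y.
  (* [u] contains [y], so [D], of the same size, is nonempty and [N y] has a positive term. *)
  move=> yu; have : (0 < size D)%N by rewrite -szu; case: (u) yu.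
  move=> D0; have xD : nth 0 D 0 \in D by rewrite mem_nth.
  rewrite /N (bigD1_seq _ xD uD) ltr_wpDr //=.
    rewrite big_seq_cond sumr_ge0 // => x /andP[/m0 mx _].
    by rewrite divr_ge0 ?sqr_ge0 ?ltW.
  by rewrite divr_gt0 ?m0 // exprn_even_gt0 //= yx.
have qy y : y \in u -> p.[y] = l * q.[y].
  move=> yu; apply/eqP; rewrite -subr_eq0 -[l * _]hornerZ -hornerN -hornerD ps.
  by rewrite horner_prod_XsubC_root.
have qy1 y : y \in u -> \sum_(x <- D) m x / (y - x) = l^-1.
  move=> yu; apply: (mulIf (p0 y yu)); rewrite [in RHS]qy // mulKf //.
  rewrite horner_sum mulr_suml [LHS]big_seq [RHS]big_seq; apply: eq_bigr => x xD.
  by rewrite hornerZ horner_omit // ?nyx // mulrAC mulrA.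
(* Since [s / p] is [1 - l \sum_x m x / (X - x)], its derivative at a zero [y] is both
   [s'(y) / p(y)] and [l * N y]. *)
have s' y : y \in u -> s^`().[y] = l * p.[y] * N y.
  move=> yu; rewrite -ps derivB derivZ raddf_sum /= hornerD hornerN hornerZ.
  rewrite horner_sum.
  have -> : \sum_(x <- D) (m x *: omit D x)^`().[y] =
    p^`().[y] * (\sum_(x <- D) m x / (y - x)) - p.[y] * N y.
    rewrite /N !mulr_sumr -sumrB [LHS]big_seq [RHS]big_seq; apply: eq_bigr => x xD.
    rewrite derivZ hornerZ /p (prod_XsubC_omit uD xD) derivM derivXsubC !hornerE.
    move: (yx x y xD yu).
    by move: (y - x) (omit D x)^`().[y] (omit D x).[y] => z o1 o z0 /=; field.
  by rewrite qy1 //; move: p.[y] p^`().[y] (N y) => a b c; field.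
have uu : uniq u.
  apply: uniq_prod_XsubC_deriv => y yu.
  by rewrite s' // !mulf_neq0 ?p0 // gt_eqF ?N0.
have oy y : y \in u -> (omit u y).[y] = l * p.[y] * N y.
  by move=> yu; rewrite -deriv_prod_XsubC_root // s'.
(* The partial fraction expansion of [h / s], whose residue at [y] is [h(y) / s'(y)]. *)
have lag (h : {poly F}) x : (size h <= size u)%N -> x \in D ->
    h.[x] = s.[x] * \sum_(y <- u) h.[y] / (l * p.[y] * N y) / (x - y).
  move=> hu xD; rewrite {1}(lagrange_prod_XsubC uu hu) horner_sum mulr_sumr.
  rewrite [LHS]big_seq [RHS]big_seq; apply: eq_bigr => y yu.
  by rewrite hornerZ oy // horner_omit ?nxy // mulrCA mulrA.
have szq : (size q <= size u)%N.
  rewrite szu (leq_trans (size_sum _ _ _)) //; apply/bigmax_leqP_seq => x xD _.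
  by rewrite (leq_trans (size_scale_leq _ _)) // size_omit.
exists (fun x y => m x / (y - x) ^+ 2 / N y); split=> [x y xD yu|x xD|y yu|x xD].
- by rewrite divr_ge0 ?divr_ge0 ?sqr_ge0 ?ltW ?m0 ?N0.
- have := lag (omit D x) x; rewrite szu size_omit // => /(_ isT xD).
  rewrite sx // => H; apply: (mulfI (omit0 x)); rewrite mulr1 [RHS]H.
  rewrite !mulr_sumr [LHS]big_seq [RHS]big_seq; apply: eq_bigr => y yu.
  rewrite (horner_omit uD xD (nyx x y xD yu)) -[x - y]opprB.
  have := yx x y xD yu; have := p0 y yu; have := lt0r_neq0 (N0 y yu).
  move: (y - x) p.[y] (N y) (omit D x).[x] => d a b o b0 a0 d0 /=; field.
  by rewrite d0 b0 a0 l0.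
- by rewrite -mulr_suml divff // gt_eqF ?N0.
- have := lag q x szq xD; rewrite qE // sx // => H.
  apply: (mulfI (mulf_neq0 (omit0 x) (invr_neq0 l0))).
  transitivity (m x * (omit D x).[x]); last by field.
  rewrite [RHS]H !mulr_sumr [LHS]big_seq [RHS]big_seq; apply: eq_bigr => y yu.
  have := p0 y yu; rewrite qy // -[x - y]opprB.
  have := yx x y xD yu; have := lt0r_neq0 (N0 y yu).
  move: (y - x) q.[y] (N y) (omit D x).[x] => d a b o b0 d0 /=.
  by rewrite mulf_eq0 negb_or => /andP[_ a0]; field; rewrite d0 b0 a0 l0.
Qed.

(** * Majorization along the shift of a basis [{P, P'}] *)

Lemma sum_flatten_nseq (T : Type) (V : nmodType) (D : seq T)
    (k : T -> nat) (g : T -> V) :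
  \sum_(x <- flatten [seq nseq (k x) x | x <- D]) g x = \sum_(x <- D) g x *+ k x.
Proof.
rewrite big_flatten big_map; apply: eq_bigr => x _.
by rewrite big_nseq iter_addr_0.
Qed.

Lemma prod_flatten_nseq (T : Type) (S : pzSemiRingType) (D : seq T)
    (k : T -> nat) (g : T -> S) :
  \prod_(x <- flatten [seq nseq (k x) x | x <- D]) g x = \prod_(x <- D) g x ^+ k x.
Proof.
rewrite big_flatten big_map; apply: eq_bigr => x _.
by rewrite big_nseq iter_mulr_1.
Qed.

Lemma prod_XsubC_dvdp (F : fieldType) (s : {poly F}) (t : seq F) :
  s \is monic -> s %| \prod_(x <- t) ('X - x%:P) ->
  exists u, s = \prod_(x <- u) ('X - x%:P).
Proof.
move=> ms /dvdp_prod_XsubC[k]; rewrite eqp_monic ?monic_prod_XsubC // => /eqP ->.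
by exists (mask k t).
Qed.

(** For each [x], one supporting line at [x] serves both the points [y - l] and the point [x - l].
    The slope terms [g * (m x * l - l)] and [- g * l * (m x - 1)] cancel. *)
Lemma subgradient_weights_le (R : realFieldType) (D u : seq R) (m : R -> R)
    (l : R) (W : R -> R -> R) (f : R -> R) :
  {in D, forall x, 1 <= m x} ->
  {in D & u, forall x y, 0 <= W x y} ->
  {in D, forall x, \sum_(y <- u) W x y = 1} ->
  {in u, forall y, \sum_(x <- D) W x y = 1} ->
  {in D, forall x, \sum_(y <- u) W x y * (y - x) = m x * l} ->
  (forall x, exists g, forall y, f x + g * (y - x) <= f y) ->
  \sum_(x <- D) f x * m x <=
    \sum_(y <- u) f (y - l) + \sum_(x <- D) f (x - l) * (m x - 1).
Proof.
move=> m1 W0 row col mean sg.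
have -> : \sum_(y <- u) f (y - l) =
    \sum_(x <- D) \sum_(y <- u) W x y * f (y - l).
  rewrite exchange_big [LHS]big_seq [RHS]big_seq; apply: eq_bigr => y yu.
  by rewrite -mulr_suml col // mul1r.
rewrite -big_split big_seq [leRHS]big_seq; apply: ler_sum => x xD /=.
have [g fg] := sg x.
have : \sum_(y <- u) W x y * (f x + g * (y - l - x)) <=
    \sum_(y <- u) W x y * f (y - l).
  rewrite big_seq [leRHS]big_seq; apply: ler_sum => y yu.
  by rewrite ler_wpM2l ?W0.
have -> : \sum_(y <- u) W x y * (f x + g * (y - l - x)) =
    f x - g * l + g * (m x * l).
  rewrite -mean // mulr_sumr -[f x - g * l]mul1r -(row x xD) mulr_suml -big_split.
  by apply: eq_bigr => y _ /=; ring.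
have := ler_wpM2r (_ : 0 <= m x - 1) (fg (x - l)).
rewrite subr_ge0 m1 // => /(_ isT); lra.
Qed.

Lemma spectral_le_shift_deriv (R : realType) (P : {poly R}) (l : R)
    (t t' : seq R) :
  P = \prod_(x <- t) ('X - x%:P) ->
  P - l *: P^`() = \prod_(x <- t') ('X - x%:P) ->
  spectral_le P (pencil_shift P P^`() l).
Proof.
move=> Pt PlP'; rewrite pencil_shiftE.
have [->|l0] := eqVneq l 0.
  by rewrite scale0r subr0 addr0 comp_polyXr => f _.
pose D := undup t; pose m x : R := (count_mem x t)%:R.
(* Each zero of [P] with its multiplicity lowered by one: [d] is the common factor of [P] and [P'],
   with [P = p * d] and [P' = d * q]. *)
pose v := flatten [seq nseq (count_mem x t).-1 x | x <- D].
pose p := \prod_(x <- D) ('X - x%:P); pose q := \sum_(x <- D) m x *: omit D x.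
pose d := \prod_(x <- v) ('X - x%:P).
have uD : uniq D by rewrite undup_uniq.
have tD : {subset t <= D} by move=> x; rewrite mem_undup.
have count_gt0 x : x \in D -> (0 < count_mem x t)%N.
  by rewrite mem_undup -has_pred1 has_count.
have Pd : P = p * d.
  rewrite Pt -prodr_undup_exp_count /d prod_flatten_nseq -big_split.
  rewrite [LHS]big_seq [RHS]big_seq; apply: eq_bigr => x xD.
  by rewrite /= -exprS prednK ?count_gt0.
have p0 : p != 0 by rewrite monic_neq0 ?monic_prod_XsubC.
have P'd : P^`() = d * q.
  apply: (mulIf p0); rewrite {1}Pt deriv_prod_XsubC_omit // -Pt Pd.
  rewrite -(perm_big _ (perm_count_undup t)) sum_flatten_nseq /q.
  under eq_bigr do rewrite -scaler_nat.
  by rewrite [RHS]mulrC mulrA.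
have szq : (size (- (l *: q)) < size p)%N.
  rewrite size_polyN size_prod_XsubC ltnS (leq_trans (size_scale_leq _ _)) //.
  rewrite (leq_trans (size_sum _ _ _)) //; apply/bigmax_leqP_seq => x xD _.
  by rewrite (leq_trans (size_scale_leq _ _)) // size_omit.
have ms : p - l *: q \is monic.
  by rewrite monicE lead_coefDl // -monicE monic_prod_XsubC.
have PlP'd : P - l *: P^`() = d * (p - l *: q).
  by rewrite P'd Pd mulrBr scalerAr mulrC.
have [|u su] := prod_XsubC_dvdp ms (t := t').
  by rewrite -PlP' PlP'd dvdp_mull.
have szu : size u = size D.
  apply/eq_add_S; rewrite -!(size_prod_XsubC _ id) -su size_polyDl //.
have m0 : {in D, forall x, 0 < m x} by move=> x /count_gt0; rewrite ltr0n.
have [W [W0 row col mean]] := doubly_stochastic_weights uD m0 l0 szu su.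
have -> : P - l *: P^`() = \prod_(x <- v ++ u) ('X - x%:P).
  by rewrite PlP'd su big_cat.
rewrite Pt comp_prod_XsubC => f cf.
rewrite !(perm_big _ (root_map_prod_XsubC _)) big_map big_cat /= addrC.
rewrite -(perm_big _ (perm_count_undup t)) !sum_flatten_nseq.
have m1 : {in D, forall x, 1 <= m x} by move=> x /count_gt0; rewrite ler1n.
have := subgradient_weights_le m1 W0 row col mean
  (fun x => convex_subgradient x cf).
rewrite [X in _ <= _ + X]big_seq.
under [X in _ <= _ + X]eq_bigr => x xD.
  rewrite -(natrB _ (count_gt0 x xD)) subn1 mulr_natr; over.
by rewrite -big_seq; under [X in X <= _]eq_bigr do rewrite /m mulr_natr.
Qed.

(** * The logarithmic barrier and the derivative at a local minimum *)

Lemma ln_le_tangent (R : realType) (a b : R) :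
  0 < a -> 0 < b -> ln b <= ln a + (b - a) / a.
Proof.
move=> a0 b0; have ba0 : 0 < b / a by rewrite divr_gt0.
have := @le_ln1Dx R (b / a - 1).
rewrite addrCA subrr addr0 ln_div ?posrE // => H.
have -> : (b - a) / a = b / a - 1 by field; rewrite gt_eqF.
have := H (ltac:(lra)); lra.
Qed.

(** The branch past [B] is the tangent at [B], which keeps the function convex on the whole line. *)
Definition log_barrier (R : realType) (B c x : R) : R :=
  if x <= B then - ln (c - x) else - ln (c - B) + (x - B) / (c - B).

Lemma log_barrier_convex (R : realType) (B c : R) :
  B < c -> convex_function setT (log_barrier B c : R^o -> R^o).
Proof.
move=> Bc.
apply: (@subgradient_convex _ _
  (fun x => if x <= B then (c - x)^-1 else (c - B)^-1)) => x y.
have tangent z w : z <= B -> w <= B ->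
    - ln (c - z) + (c - z)^-1 * (w - z) <= - ln (c - w).
  move=> zB wB; have := @ln_le_tangent R (c - z) (c - w).
  have -> : (c - w - (c - z)) / (c - z) = - ((c - z)^-1 * (w - z)) by ring.
  move=> /(_ (ltac:(lra)) (ltac:(lra))); lra.
rewrite /log_barrier; case: (leP x B) => xB; case: (leP y B) => yB.
- exact: tangent.
(* The tangent at [x] is followed up to [B]; from there the slope at [B] is at least the slope at
   [x]. *)
- have := tangent x B xB (lexx _).
  have : (c - x)^-1 * (y - B) <= (c - B)^-1 * (y - B).
    by rewrite ler_wpM2r ?lef_pV2 ?posrE; lra.
  rewrite [(y - B) / _]mulrC; lra.
- have := tangent B y (lexx _) yB; rewrite [(x - B) / _]mulrC; lra.
- rewrite ![_ / (c - B)]mulrC; lra.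
Qed.

Lemma log_barrier_sum (R : realType) (B c : R) (s : seq R) :
  B < c -> {in s, forall x, x <= B} ->
  0 < (\prod_(x <- s) ('X - x%:P)).[c] /\
  \sum_(x <- s) log_barrier B c x = - ln (\prod_(x <- s) ('X - x%:P)).[c].
Proof.
move=> Bc; elim: s => [_|a s IH sB].
  by rewrite !big_nil hornerC ln1 oppr0.
have aB : a <= B by rewrite sB ?mem_head.
have [|s0 ss] := IH; first by move=> x xs; rewrite sB // in_cons xs orbT.
have ac : 0 < c - a by lra.
rewrite !big_cons hornerM hornerXsubC mulr_gt0 // ss lnM ?posrE //.
by rewrite /log_barrier aB opprD.
Qed.

Lemma monic_gt0 (R : rcfType) (p : {poly R}) (x : R) :
  p \is monic -> cauchy_bound p <= x -> 0 < p.[x].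
Proof.
move=> mp px; have p0 := monic_neq0 mp.
have := sgp_pinftyP (ge_cauchy_bound p0).
move=> /(_ x); rewrite in_itv /= px /sgp_pinfty (monicP mp) sgr1 => /(_ isT) H.
by rewrite -sgr_cp0 H.
Qed.

Lemma poly_local_max_deriv (R : realType) (p : {poly R}) (a e : R) :
  0 < e -> (forall x, a - e < x < a + e -> p.[x] <= p.[a]) -> p^`().[a] = 0.
Proof.
move=> e0 pmax.
have H : is_derive a (1 : R) (horner p) 0.
  apply: (@derive1_at_max _ _ (a - e) (a + e)); first by lra.
  - by move=> t _; exact: derivable_horner.
  - by rewrite in_itv /=; lra.
  - by move=> t; rewrite in_itv /=; exact: pmax.
by have [_ <-] := H; have [_ <-] := is_derive_poly p a.
Qed.

(** With [c] fixed, ['X] stands for the shift parameter: the value at [l] of the polynomial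
    differentiated here is [R_l(c)]. *)
Lemma deriv_shift (R : comNzRingType) (P Q : {poly R}) (c l : R) :
  (P \Po ('X + c%:P) - 'X * (Q \Po ('X + c%:P)))^`().[l] =
  (P^`() - l *: Q^`() - Q).[l + c].
Proof.
rewrite derivB derivM derivX mul1r !deriv_comp derivD derivX derivC addr0 !mulr1.
by rewrite !(hornerE, horner_comp); ring.
Qed.

Lemma shift_local_min_deriv (R : realType) (P Q : {poly R}) (l0 e : R) :
  0 < e ->
  (forall l, P - l *: Q \is monic /\
     exists s : seq R, P - l *: Q = \prod_(x <- s) ('X - x%:P)) ->
  (forall l, l0 - e < l < l0 + e ->
     spectral_le (pencil_shift P Q l0) (pencil_shift P Q l)) ->
  (P - l0 *: Q)^`() = Q.
Proof.
move=> e0 split min.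
(* [(P - l *: Q).[z]] is affine in [l], so positivity at the two ends [l0 - 1] and [l0 + 1] gives it
   in between, and [M] bounds all the zeros uniformly. *)
pose P1 := P - (l0 - 1) *: Q; pose P2 := P - (l0 + 1) *: Q.
pose M := Num.max (cauchy_bound P1) (cauchy_bound P2).
have pos l z : l0 - 1 < l < l0 + 1 -> M <= z -> 0 < (P - l *: Q).[z].
  move=> /andP[l1 l2]; rewrite ge_max => /andP[M1 M2].
  have := monic_gt0 (split (l0 - 1)).1 M1.
  have := monic_gt0 (split (l0 + 1)).1 M2.
  rewrite !hornerE => h2 h1.
  have [Qz|Qz] := leP 0 Q.[z].
    have := ler_wpM2r Qz (ltW l2); lra.
  have := ler_wnM2r (ltW Qz) (ltW l1); lra.
(* The shift moves a zero [x < M] to [x - l], and [l > l0 - 1]. *)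
pose B := M - l0 + 1.
have shift_ln l c : l0 - 1 < l < l0 + 1 -> B < c ->
    0 < (pencil_shift P Q l).[c] /\
    \sum_(x <- root_map (pencil_shift P Q l)) log_barrier B c x =
      - ln (pencil_shift P Q l).[c].
  move=> l01 Bc; have [_ [s Ps]] := split l.
  rewrite pencil_shiftE Ps comp_prod_XsubC.
  rewrite (perm_big _ (root_map_prod_XsubC _)); apply: log_barrier_sum => //.
  move=> _ /mapP[x xs ->]; have : x < M.
    rewrite ltNge; apply/negP => /(pos _ _ l01).
    by rewrite Ps horner_prod_XsubC_root // ltxx.
  rewrite /B; lra.
apply/esym/eqP; rewrite -subr_eq0; apply/eqP.
have root_ge (c : R) : B < c -> (Q - (P - l0 *: Q)^`()).[c + l0] = 0.
  move=> Bc; pose H : {poly R} := P \Po ('X + c%:P) - 'X * (Q \Po ('X + c%:P)).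
  have HE l : H.[l] = (pencil_shift P Q l).[c].
    by rewrite pencil_shiftE /H !(hornerE, horner_comp) [l + c]addrC.
  have : H^`().[l0] = 0.
    (* Radius [e] is for the minimality hypothesis, radius [1] for the uniform bound on the
       zeros. *)
    apply: (@poly_local_max_deriv _ _ _ (Num.min e 1)).
      by rewrite lt_min e0 ltr01.
    move=> l; rewrite !HE => /andP[l1 l2].
    have [me m1] : Num.min e 1 <= e /\ Num.min e 1 <= 1.
      by rewrite !ge_min !lexx orbT.
    have le : l0 - e < l < l0 + e by lra.
    have le1 : l0 - 1 < l < l0 + 1 by lra.
    have [p0 s0] := shift_ln l0 c (ltac:(lra)) Bc.
    have [pl sl] := shift_ln l c le1 Bc.
    have := min l le _ (log_barrier_convex Bc); rewrite s0 sl lerN2.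
    by rewrite ler_ln ?posrE.
  rewrite deriv_shift => H0; apply/eqP; rewrite -oppr_eq0 -hornerN opprB.
  by rewrite derivB derivZ [c + l0]addrC H0.
apply/eqP; apply: contraT => V0.
(* [z] is a zero of [V] by [root_ge], yet lies beyond the bound on the zeros of a nonzero [V]. *)
set V := Q - _ in root_ge V0; pose z := Num.max (cauchy_bound V) (B + l0 + 1).
have zB : B + l0 + 1 <= z by rewrite le_max lexx orbT.
have /cauchy_boundP := V0.
move=> /(_ z); have := root_ge (z - l0) (ltac:(lra)).
rewrite subrK => -> /(_ erefl).
have : cauchy_bound V <= z by rewrite le_max lexx.
have := ler_norm z; lra.
Qed.

(** * Bases of pencils and the equivalence *)

Lemma basisE (R : realType) (n : nat) (L : set {poly R}) (P Q : {poly R}) :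
  is_basis n L P Q -> forall l, L (P - l *: Q).
Proof. by move=> [_ _ _ ->] l; exists l. Qed.

Theorem theorem4 (R : realType) (n : nat) (hn : (2 <= n)%N)
    (L : set {poly R}) (hL : is_pencil n L) (hLH : L `<=` hyperbolic n) :
  is_LD L <->
  exists P Q : {poly R}, is_basis n L P Q /\
    exists l0 eps : R, 0 < eps /\
      forall l : R, l0 - eps < l < l0 + eps ->
        spectral_le (pencil_shift P Q l0) (pencil_shift P Q l).
Proof.
split=> [[Q1 [Q2 [Q3 [LQ1 LQ2 LQ3 Q3E]]]]|[P [Q [PQ [l0 [e [e0 min]]]]]]].
- have [mQ3 szQ3] := (hLH _ LQ3).1.
  have lcQ3 : lead_coef Q3^`() = n%:R.
    rewrite lead_coefE size_deriv szQ3 /= coef_deriv prednK ?(ltnW hn) //.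
    by move/monicP: mQ3; rewrite lead_coefE szQ3 /= => ->.
  have basis : is_basis n L Q3 Q3^`().
    split=> //; first by rewrite size_deriv szQ3.
    case: hL => P1 [P2 [_ _ _ LE]].
    move: LQ1 LQ2 LQ3; rewrite LE => -[l1 _ E1] [l2 _ E2] [l3 _ E3].
    have Q3'E : Q3^`() = (l1 - l2) *: (P2 - P1).
      by rewrite Q3E -E1 -E2 -!mul_polyC !(polyCB, polyC1); ring.
    have k0 : l1 - l2 != 0.
      apply: contraTneq (ltnW hn) => k0; rewrite -eqn0Ngt -(pnatr_eq0 R) -lcQ3.
      by rewrite Q3'E k0 scale0r lead_coef0.
    have shiftE a : Q3 - a *: Q3^`() =
        (1 - (l3 - a * (l1 - l2))) *: P1 + (l3 - a * (l1 - l2)) *: P2.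
      by rewrite Q3'E -E3 -!mul_polyC !(polyCB, polyCM, polyC1); ring.
    apply/seteqP; split=> [_ [l _ <-]|_ [a _ <-]].
      exists ((l3 - l) / (l1 - l2)) => //.
      by rewrite shiftE divfK // subKr.
    by exists (l3 - a * (l1 - l2)).
  (* The minimum at [0] is global, so any radius will do. *)
  exists Q3, Q3^`(); split=> //; exists 0, 1; split=> // l _.
  have [t Q3t] := hyperbolic_split (hLH _ LQ3).
  have [t' lt'] := hyperbolic_split (hLH _ (basisE basis l)).
  have := spectral_le_shift_deriv Q3t lt'.
  by rewrite {2}/pencil_shift scale0r subr0 addr0 comp_polyXr.
- have Lmem := basisE PQ.
  have hyp l := hLH _ (Lmem l).
  have := shift_local_min_deriv e0 _ min => H.
  (* The first two differ by [Q], which by [H] is the derivative of [P - l0 *: Q]. *)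
  exists (P - l0 *: Q), (P - (l0 + 1) *: Q), (P - l0 *: Q).
  split; [exact: Lmem..|].
  rewrite H => [|l].
    by rewrite scalerDl scale1r; ring.
  by split; [exact: (hyp l).1.1|exact: hyperbolic_split (hyp l)].
Qed.
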